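(* Let $f:C\to\mathbb{R}$ be a convex differentiable function on a closed convex set $C\subseteq\mathbb{R}^n$ with $f^{\min}=\min_{x\in C}f(x)$, and let $f_H:\mathbb{R}^{n_H}\to(-\infty,\infty]$ be a convex coarse function. Assume: (A) $f$ is $L$-smooth relative to $\varphi$ on $C$ for some $L>0$, and for every $x\in\operatorname{int}C$ and $\tau>0$ the problem $\min_{u\in C}\{\tau\langle\nabla f(x),u-x\rangle+D_\varphi(u,x)\}$ has a unique solution $x_\tau^+$, and $x_\tau^+\in\operatorname{int}C$. (B) There are a function $\theta:\mathbb{R}_{++}\to\mathbb{R}_{++}$ and $\eta>0$ such that for all $x\in\operatorname{int}C$ and $\tau>0$: $D_\varphi(x,x_\tau^+)\ge\theta(\tau)D_\varphi(x,x_1^+)$ and $D_\varphi(x,x_1^+)\ge\eta\,(f(x)-f^{\min})$. (C) There is $L_H>0$ such that $f_H$ is $L_H$-smooth relative to $\varphi_H$ on $C_H^k$ for all $k$, and each coarse subproblem $\min_{u\in C_H^k}\{\tau_H\langle\nabla\psi^k(x),u-x\rangle+D_{\varphi_H}(u,x)\}$ ($x\in\operatorname{int}C_H^k$) has a unique solution, lying in $\operatorname{int}C_H^k$. Let $\tau\in(0,L^{-1}]$ and $\tau_H\in(0,L_H^{-1}]$ be constant step sizes, and let $\{x^k\}_{k\in\mathbb{N}}$ be the iterates generated by the two-level BPGD algorithm (described in the context) started at $x^0\in\operatorname{int}C$, where the coarse corrections $z^{k+1}$ are obtained by the Armijo backtracking line search with parameter $\sigma\in(0,1)$ and resulting steps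 $\alpha_k$. Then the function values $f(x^k)$ converge. More precisely, with $r:=\frac{\theta(\tau)\eta}{\tau}$, for every $k$, $$f(x^k)-f^{\min}\le(1-r)^k\,(f(x^0)-f^{\min})-\sum_{j=0}^{k-1}(1-r)^{k-j}\rho^j,$$ where $$\rho^j=\begin{cases}\displaystyle\sigma\alpha_j\sum_{i=1}^m\frac{D_{\varphi_H}(x_H^{i-1,j},x_H^{i,j})}{\tau_H},&\text{if iteration } j \text{ triggers a coarse correction},\\[2mm]0,&\text{otherwise.}\end{cases}$$
   Context: $\operatorname{int}$ denotes the interior (relative interior if the set has empty interior). $\mathbb{R}_{++}=(0,\infty)$. Bregman divergence: for $\varphi$ convex and differentiable at $y$, $D_\varphi(x,y)=\varphi(x)-\varphi(y)-\langle\nabla\varphi(y),x-y\rangle$. A function $g$ is $L$-smooth relative to $\varphi$ on a convex set $K$ if $D_g(x,y)\le L\,D_\varphi(x,y)$ for all $x\in K$, $y\in\operatorname{int}K$. The reference functions $\varphi:\mathbb{R}^n\to(-\infty,\infty]$ and $\varphi_H:\mathbb{R}^{n_H}\to(-\infty,\infty]$ are convex, strictly convex on $C$ respectively on all $C_H^k$, and differentiable on $\operatorname{int}\operatorname{dom}\varphi\supseteq\operatorname{int}C$ respectively $\operatorname{int}\operatorname{dom}\varphi_H\supseteq\operatorname{int}C_H^k$. Transfer operators: linear maps $R:\mathbb{R}^n\to\mathbb{R}^{n_H}$ and $P:\mathbb{R}^{n_H}\to\mathbb{R}^n$ with $R=P^\top$. Coarse model at iteration $k$, given $x^k$: $f_H$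 is differentiable where needed, and $\psi^k(x)=f_H(x)+\langle v^k,x-Rx^k\rangle$ with $v^k=R\nabla f(x^k)-\nabla f_H(Rx^k)$. The coarse constraint set $C_H^k\subseteq\mathbb{R}^{n_H}$ is closed and convex, satisfies $C_H^k\subseteq\{w\in\mathbb{R}^{n_H}: x^k+P(w-Rx^k)\in C\}$, and $Rx^k\in\operatorname{int}C_H^k$. Two-level BPGD algorithm, iteration $k$, from $x^k\in\operatorname{int}C$: an (arbitrary but fixed) criterion decides whether a coarse correction is triggered. If triggered: set $x_H^{0,k}=Rx^k$; for $i=1,\dots,m$ ($m\ge1$ fixed) set $x_H^{i,k}=\arg\min_{u\in C_H^k}\{\tau_H\langle\nabla\psi^k(x_H^{i-1,k}),u-x_H^{i-1,k}\rangle+D_{\varphi_H}(u,x_H^{i-1,k})\}$; set $d_k=P(x_H^{m,k}-x_H^{0,k})$; find a step $\alpha_k\in(0,1]$ by line search; set $z^{k+1}=x^k+\alpha_kd_k\in\operatorname{int}C$; and set $x^{k+1}=(z^{k+1})_\tau^+=\arg\min_{u\in C}\{\tau\langle\nabla f(z^{k+1}),u-z^{k+1}\rangle+D_\varphi(u,z^{k+1})\}$. If not triggered: $x^{k+1}=(x^k)_\tau^+$. Armijo backtracking: given constants $\bar\alpha>0$ and $\beta,\sigma\in(0,1)$, the step is $\alpha_k=\beta^p\bar\alpha$, with $p$ the smallest nonnegative integer such that $f(x^k+\alpha_kd_k)\le f(x^k)+\sigma\alpha_k\langle\nabla f(x^k),d_k\rangle$. It is understood that the parameters are such that $\alpha_k\in(0,1]$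 and $z^{k+1}\in\operatorname{int}C$. *)

(* Defs.v *)
From HB Require Import structures.
From mathcomp Require Import all_boot all_order all_algebra.
From mathcomp Require Import all_classical all_reals all_analysis.
From mathcomp Require Import ring.

Set Implicit Arguments.
Unset Strict Implicit.
Unset Printing Implicit Defensive.

Import Order.TTheory GRing.Theory Num.Theory.
Import numFieldNormedType.Exports.

Local Open Scope classical_set_scope.
Local Open Scope ring_scope.

(* R^n is modelled by the column vectors 'cV[R]_n, so that a linear map is
   x |-> A *m x. Functions into (-oo, +oo] take values in \bar R. *)

Section interior.
Context {R : realType} {n : nat}.
Implicit Types A M : set 'cV[R]_n.

Definition affine_set M :=
  forall (x y : 'cV[R]_n) (t : R), M x -> M y -> M (t *: x + (1 - t) *: y).

Definition affine_hull A : set 'cV[R]_n :=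
  \bigcap_(M in [set M | affine_set M /\ A `<=` M]) M.

Definition relative_interior A : set 'cV[R]_n :=
  [set x | A x /\ within (affine_hull A) (nbhs x) A].

(* int A: the interior, or the relative interior when the
   interior is empty. *)
Definition ginterior A : set 'cV[R]_n :=
  A° `|` [set x | A° = set0 /\ relative_interior A x].

End interior.

Section convex_analysis.
Context {R : realType} {n : nat}.
Implicit Types (x y u : 'cV[R]_n) (A C K : set 'cV[R]_n).
Implicit Types (phi h : 'cV[R]_n -> \bar R) (dphi dh g : 'cV[R]_n -> 'cV[R]_n).

Definition dot u x : R := \sum_i u i 0 * x i 0.

Definition edom phi : set 'cV[R]_n := [set x | (phi x < +oo)%E].

Definition econvex phi := forall x y (t : R), 0 <= t <= 1 ->
  (phi (t *: x + (1 - t) *: y)%R <= t%:E * phi x + (1 - t)%:E * phi y)%E.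

(* Only points of finite value are compared: C may contain points outside
   edom phi, where both sides could be +oo. *)
Definition strictly_econvex_on C phi := forall x y (t : R),
  C x -> C y -> edom phi x -> edom phi y -> x != y -> 0 < t < 1 ->
  (phi (t *: x + (1 - t) *: y)%R < t%:E * phi x + (1 - t)%:E * phi y)%E.

(* v is a gradient at x of the function f with domain A. At a point interior
   to A this is the usual gradient; if A has empty interior, v is determined
   only up to vectors orthogonal to the directions of A. *)
Definition is_gradient A (f : 'cV[R]_n -> R) x (v : 'cV[R]_n) :=
  A x /\ forall e : R, 0 < e -> \forall y \near within A (nbhs x),
    `|f y - f x - dot v (y - x)| <= e * `|y - x|.

Definition gradient_on K A (f : 'cV[R]_n -> R) g :=
  forall x, K x -> is_gradient A f x (g x).

(* Divergence D_phi(x, y), dphi being a gradient field of phi. *)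
Definition bregman phi dphi x y : \bar R :=
  (phi x - phi y - (dot (dphi y) (x - y)%R)%:E)%E.

Definition relatively_smooth K h dh phi dphi (L : R) :=
  forall x y, K x -> ginterior K y ->
    (bregman h dh x y <= L%:E * bregman phi dphi x y)%E.

Record reference_function C phi dphi : Prop := ReferenceFunction {
  ref_proper : forall x, (-oo < phi x)%E ;
  ref_convex : econvex phi ;
  ref_strict : strictly_econvex_on C phi ;
  ref_dom    : ginterior C `<=` ginterior (edom phi) ;
  ref_diff   : gradient_on (ginterior (edom phi)) (edom phi) (fine \o phi) dphi
}.

Definition is_argmin K h u := K u /\ forall w, K w -> (h u <= h w)%E.

Definition argmin K h : 'cV[R]_n := xget 0 (is_argmin K h).

Definition bpg_objective g phi dphi (t : R) x u : \bar R :=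
  ((t * dot (g x) (u - x)%R)%:E + bregman phi dphi u x)%E.

(* x_t^+ *)
Definition bpg_step K g phi dphi (t : R) x : 'cV[R]_n :=
  argmin K (bpg_objective g phi dphi t x).

Definition bpg_well_posed K g phi dphi (t : R) := forall x, ginterior K x ->
  (exists! u, is_argmin K (bpg_objective g phi dphi t x) u) /\
  ginterior K (bpg_step K g phi dphi t x).

(* The trial point must belong to C, since f is only defined there. *)
Definition armijo_test C (f : 'cV[R]_n -> R) g (sigma : R) x (d : 'cV[R]_n)
    (a : R) :=
  C (x + a *: d) /\ f (x + a *: d) <= f x + sigma * a * dot (g x) d.

Definition armijo_step C f g (abar beta sigma : R) x (d : 'cV[R]_n) (a : R) :=
  exists p : nat,
    [/\ a = beta ^+ p * abar,
        armijo_test C f g sigma x d (beta ^+ p * abar) &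
        forall q, (q < p)%N -> ~ armijo_test C f g sigma x d (beta ^+ q * abar)].

End convex_analysis.

Section two_level.
Context {R : realType} {n nH : nat}.
Variables (Rs : 'M[R]_(nH, n)) (P : 'M[R]_(n, nH)).
Variables (df : 'cV[R]_n -> 'cV[R]_n).
Variables (fH : 'cV[R]_nH -> \bar R) (dfH : 'cV[R]_nH -> 'cV[R]_nH).
Implicit Types x : 'cV[R]_n.

Definition coarse_shift x : 'cV[R]_nH := Rs *m df x - dfH (Rs *m x).

Definition coarse_model x (w : 'cV[R]_nH) : \bar R :=
  (fH w + (dot (coarse_shift x) (w - Rs *m x)%R)%:E)%E.

(* See coarse_gradientP. *)
Definition coarse_gradient x (w : 'cV[R]_nH) : 'cV[R]_nH :=
  dfH w + coarse_shift x.

Lemma coarse_gradientP x (w : 'cV[R]_nH) : (forall u, (-oo < fH u)%E) ->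
  is_gradient (edom fH) (fine \o fH) w (dfH w) ->
  is_gradient (edom (coarse_model x)) (fine \o coarse_model x) w
    (coarse_gradient x w).
Proof.
move=> fHNy [wfin fHw]; have domE : edom (coarse_model x) = edom fH.
  apply/funext => u; rewrite /edom /= /coarse_model.
  by apply/propext; case: (fH u) => [r||] //=; rewrite !ltry.
have fineE u : edom fH u -> fine (coarse_model x u) =
    fine (fH u) + dot (coarse_shift x) (u - Rs *m x).
  rewrite /edom /= /coarse_model; have := fHNy u.
  by case: (fH u).
rewrite domE; split=> // e e0; have := fHw e e0; rewrite !near_withinE.
apply: filterS => u /= uh uA; have := uh uA; rewrite !fineE//.
congr (`| _ | <= _); rewrite /coarse_gradient /dot.
have -> : \sum_i (dfH w + coarse_shift x) i 0 * (u - w) i 0 =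
  \sum_i dfH w i 0 * (u - w) i 0 +
  (\sum_i coarse_shift x i 0 * (u - Rs *m x) i 0 -
   \sum_i coarse_shift x i 0 * (w - Rs *m x) i 0).
  rewrite -sumrB -big_split /=; apply: eq_bigr => i _.
  by rewrite !mxE; ring.
by ring.
Qed.

Variables (CH : set 'cV[R]_nH) (phiH : 'cV[R]_nH -> \bar R).
Variables (dphiH : 'cV[R]_nH -> 'cV[R]_nH) (tauH : R).

(* The iterate x_H^i of the coarse level, started from R x. *)
Definition coarse_iterate x (i : nat) : 'cV[R]_nH :=
  iter i (bpg_step CH (coarse_gradient x) phiH dphiH tauH) (Rs *m x).

Definition coarse_direction (m : nat) x : 'cV[R]_n :=
  P *m (coarse_iterate x m - coarse_iterate x 0).

End two_level.

(* Main.v *)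
Require Import Defs.
From HB Require Import structures.
From mathcomp Require Import all_boot all_order all_algebra.
From mathcomp Require Import all_classical all_reals all_analysis.
From mathcomp Require Import ring lra.

(** Everything rests on one inequality for a Bregman proximal gradient step.
    If [y] minimizes [t <g x, u - x> + D_phi(u, x)] over a convex set, then the
    directional derivative of this objective at [y] in the direction [x - y] is
    nonnegative, which reads
      [t <g x, y - x> <= - D_phi(x, y) - D_phi(y, x)]
    ([bpg_step_first_order]). Relative smoothness bounds the error of the
    linear model by [L D_phi(y, x)], and [t L <= 1] lets the term
    [- D_phi(y, x)] absorb it; the objective thus decreases by at least
    [D_phi(x, y) / t] ([bpg_descent]). This is used twice.

    On the fine level the growth condition (B) bounds [D_phi(x, y)] below by
    [theta eta] times the gap [f x - fmin], so a fine step multiplies the gap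
    by at most [1 - r] ([bpg_contraction]).

    On the coarse level the model [psi = f_H + <v, .>] decreases by
    [D_phiH(x_H^{i-1}, x_H^i) / tau_H] at each step. The shift [v] makes the
    gradient of [psi] at [R x] equal to [R (df x)], and [R] is the transpose of
    [P], so [<df x, P w>] is the slope of [psi] at [R x] along [w]. Convexity of
    [f_H] bounds this slope by the total decrease of [psi]: the coarse
    correction is a descent direction with a quantified slope
    ([coarse_direction_descent]), and the Armijo inequality turns it into a
    decrease of [f] by at least [rho].

    An iteration therefore replaces the gap [F] by at most [(1 - r) (F - rho)].
    Unrolling the recurrence gives the bound when [1 - r >= 0]; otherwise the
    contraction forces all gaps, hence all [rho], to vanish
    ([contraction_convergence]). *)

Set Implicit Arguments.
Unset Strict Implicit.
Unset Printing Implicit Defensive.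

Import Order.TTheory GRing.Theory Num.Theory.
Import numFieldNormedType.Exports.

Local Open Scope classical_set_scope.
Local Open Scope ring_scope.

(** * Inner product *)

Section dot.
Context {R : realType} {n : nat}.
Implicit Types u v w : 'cV[R]_n.

Lemma dotDl u v w : dot (u + v) w = dot u w + dot v w.
Proof. by rewrite /dot -big_split; apply: eq_bigr => i _; rewrite mxE mulrDl. Qed.

Lemma dotNl u v : dot (- u) v = - dot u v.
Proof. by rewrite /dot -sumrN; apply: eq_bigr => i _; rewrite mxE mulNr. Qed.

Lemma dotDr u v w : dot u (v + w) = dot u v + dot u w.
Proof. by rewrite /dot -big_split; apply: eq_bigr => i _; rewrite mxE mulrDr. Qed.

Lemma dotNr u v : dot u (- v) = - dot u v.
Proof. by rewrite /dot -sumrN; apply: eq_bigr => i _; rewrite mxE mulrN. Qed.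

Lemma dotZl u v a : dot (a *: u) v = a * dot u v.
Proof. by rewrite /dot big_distrr; apply: eq_bigr => i _; rewrite mxE /= mulrA. Qed.

Lemma dotZr u v a : dot u (a *: v) = a * dot u v.
Proof. by rewrite /dot big_distrr; apply: eq_bigr => i _; rewrite mxE /=; ring. Qed.

Lemma dot_mulmx p (M : 'M[R]_(n, p)) u (w : 'cV[R]_p) :
  dot u (M *m w) = dot (M^T *m u) w.
Proof.
have dotE q (a b : 'cV[R]_q) : dot a b = (a^T *m b) 0 0.
  by rewrite mxE; apply: eq_bigr => i _; rewrite mxE.
by rewrite !dotE trmx_mul trmxK mulmxA.
Qed.

End dot.

(** * Gradients along segments *)

Section gradient.
Context {R : realType} {n : nat}.
Implicit Types (x y v w : 'cV[R]_n) (A K : set 'cV[R]_n).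

Lemma ginteriorW A : ginterior A `<=` A.
Proof. by move=> x [/interior_subset//|[_ []]]. Qed.

(** The gradient is relative to the domain [A], so it can only be tested along
    directions [w] in which a segment issued from [x] stays inside [A]. This
    one-sided differential quotient is all that is ever used, so that the
    interior and the relative interior need no separate treatment. *)
Lemma gradient_along_segment A (h : 'cV[R]_n -> R) x v w :
  is_gradient A h x v ->
  (forall t, 0 < t <= 1 -> A (x + t *: w)) ->
  forall e, 0 < e -> exists2 t, 0 < t <= 1 &
    `|h (x + t *: w) - h x - t * dot v w| <= e * t.
Proof.
move=> [_ hx] segA e e0.
(* The tolerance [e] for the quotient in [t] is divided by the length of [w],
   plus one because [w] may vanish; [t] is chosen so that [t * |w| < d] and
   [t <= 1] both hold. *)
have w1 : 0 < `|w| + 1 by rewrite ltr_wpDl.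
have := hx (e / (`|w| + 1)) (divr_gt0 e0 w1).
rewrite near_withinE => /nbhs_ballP[d /= d0 hd].
have den0 : 0 < `|w| + 1 + d by rewrite addr_gt0.
pose t := d / (`|w| + 1 + d).
have t0 : 0 < t by rewrite divr_gt0.
have t01 : 0 < t <= 1.
  by rewrite t0 /= /t ler_pdivrMr// mul1r lerDr ltW.
have tw : t * `|w| < d.
  rewrite /t mulrAC ltr_pdivrMr// ltr_pM2l//.
  by rewrite -addrA ltrDl addr_gt0.
exists t => //.
have := hd (x + t *: w); rewrite -ball_normE /= opprD addrA subrr add0r normrN.
rewrite normrZ (gtr0_norm t0) => /(_ tw (segA _ t01)).
rewrite (addrC x) addrK dotZr normrZ (gtr0_norm t0) => /le_trans; apply.
rewrite mulrCA mulrC ler_pM2r//.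
by rewrite mulrAC ler_pdivrMr// ler_pM2l// lerDl.
Qed.

Lemma gradient_ge A (h : 'cV[R]_n -> R) x v w c :
  is_gradient A h x v ->
  (forall t, 0 < t <= 1 -> A (x + t *: w)) ->
  (forall t, 0 < t <= 1 -> t * c <= h (x + t *: w) - h x) ->
  c <= dot v w.
Proof.
move=> hx segA hc; apply/ler_addgt0Pr => e e0.
have [t t01] := gradient_along_segment hx segA e0.
rewrite ler_norml => /andP[_ ht]; have /andP[t0 _] := t01.
rewrite -(ler_pM2l t0); have := hc _ t01; lra.
Qed.

Lemma gradient_le A (h : 'cV[R]_n -> R) x v w c :
  is_gradient A h x v ->
  (forall t, 0 < t <= 1 -> A (x + t *: w)) ->
  (forall t, 0 < t <= 1 -> h (x + t *: w) - h x <= t * c) ->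
  dot v w <= c.
Proof.
move=> hx segA hc; apply/ler_addgt0Pr => e e0.
have [t t01] := gradient_along_segment hx segA e0.
rewrite ler_norml => /andP[ht _]; have /andP[t0 _] := t01.
rewrite -(ler_pM2l t0); have := hc _ t01; lra.
Qed.

Lemma segmentE x y (t : R) : x + t *: (y - x) = t *: y + (1 - t) *: x.
Proof. by rewrite scalerBr scalerBl scale1r addrCA. Qed.

Lemma convex_set_segment K x y (t : R) : convex_set K -> K x -> K y ->
  0 < t <= 1 -> K (x + t *: (y - x)).
Proof.
move=> cK Kx Ky /andP[t0 t1].
have t01 : Itv.spec (@Itv.num_sem R) (Itv.Real `[0%Z, 1%Z]) t.
  by rewrite /= /Itv.num_sem/= num_real /= in_itv/= ltW.
have /set_mem := cK y x (Itv.mk t01) (mem_set Ky) (mem_set Kx).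
by rewrite segmentE.
Qed.

End gradient.

(** * Proper convex functions *)

Section proper_convex.
Context {R : realType} {n : nat}.
Variable h : 'cV[R]_n -> \bar R.
Hypothesis hproper : forall x, (-oo < h x)%E.
Implicit Types (x y v : 'cV[R]_n).

Lemma fineE_edom x : edom h x -> h x = (fine (h x))%:E.
Proof. by rewrite /edom /=; have := hproper x; case: (h x). Qed.

Lemma bregmanE dh x y : edom h x -> edom h y ->
  bregman h dh x y = (fine (h x) - fine (h y) - dot (dh y) (x - y))%:E.
Proof. by move=> /fineE_edom hx /fineE_edom hy; rewrite /bregman hx hy. Qed.

Hypothesis hconvex : econvex h.

Lemma edom_segment x y (t : R) : edom h x -> edom h y -> 0 < t <= 1 ->
  edom h (x + t *: (y - x)) /\
  fine (h (x + t *: (y - x))) - fine (h x) <= t * (fine (h y) - fine (h x)).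
Proof.
move=> /fineE_edom hx /fineE_edom hy /andP[t0 t1]; rewrite segmentE.
have := @hconvex y x t; rewrite (ltW t0) t1 hx hy => /(_ isT).
have := hproper (t *: y + (1 - t) *: x).
rewrite /edom /=; case: (h _) => [r||]//= _.
by rewrite ltry -!EFinM -EFinD lee_fin => ?; split => //; lra.
Qed.

(** By convexity each chord from [x] to [x + t (y - x)] has slope at most
    [h y - h x]; the directional derivative is the limit of these slopes. *)
Lemma gradient_inequality x y v : is_gradient (edom h) (fine \o h) x v ->
  edom h y -> dot v (y - x) <= fine (h y) - fine (h x).
Proof.
move=> gx hy; have hx : edom h x by case: gx.
apply: (gradient_le gx) => t t01 /=; last exact: (edom_segment hx hy t01).2.
exact: (edom_segment hx hy t01).1.
Qed.

End proper_convex.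

(** * Bregman proximal gradient steps *)

Section bpg_step.
Context {R : realType} {n : nat}.
Variables (K : set 'cV[R]_n) (phi : 'cV[R]_n -> \bar R).
Variable dphi : 'cV[R]_n -> 'cV[R]_n.
Hypotheses (Kconvex : convex_set K) (phiref : reference_function K phi dphi).
Implicit Types (L t : R) (x y : 'cV[R]_n) (g : 'cV[R]_n -> 'cV[R]_n).

Let proper := ref_proper phiref.

Lemma reference_edom : ginterior K `<=` edom phi.
Proof. by move=> x /(ref_dom phiref) /ginteriorW. Qed.

Lemma reference_gradient x : ginterior K x ->
  is_gradient (edom phi) (fine \o phi) x (dphi x).
Proof. by move=> /(ref_dom phiref) /(ref_diff phiref). Qed.

Lemma reference_bregmanE x y : ginterior K x -> ginterior K y ->
  bregman phi dphi x y =
    (fine (phi x) - fine (phi y) - dot (dphi y) (x - y))%:E.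
Proof. by move=> ? ?; apply: (bregmanE proper); exact: reference_edom. Qed.

Lemma fine_bregmanK x y : ginterior K x -> ginterior K y ->
  (fine (bregman phi dphi x y))%:E = bregman phi dphi x y.
Proof. by move=> Kx Ky; rewrite reference_bregmanE. Qed.

Lemma bregman_ge0 x y : ginterior K x -> ginterior K y ->
  0 <= fine (bregman phi dphi x y).
Proof.
move=> Kx Ky; rewrite reference_bregmanE//= subr_ge0.
apply: (gradient_inequality proper (ref_convex phiref)).
  exact: reference_gradient.
exact: reference_edom.
Qed.

(** The values of [phi] cancel in the symmetrized divergence, which is what
    identifies the optimality condition of a step with a pair of divergences. *)
Lemma bregman_sym x y : ginterior K x -> ginterior K y ->
  fine (bregman phi dphi x y) + fine (bregman phi dphi y x) =
    dot (dphi y - dphi x) (y - x).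
Proof.
move=> Kx Ky; rewrite !reference_bregmanE//= -(opprB y x) dotNr dotDl dotNl.
lra.
Qed.

Lemma bpg_step_argmin g t x : bpg_well_posed K g phi dphi t -> ginterior K x ->
  is_argmin K (bpg_objective g phi dphi t x) (bpg_step K g phi dphi t x).
Proof. by move=> wp /wp[[u [um _]] _]; apply: xgetPex; exists u. Qed.

(** First-order optimality of the step, tested in the direction of the starting
    point: the objective has nonnegative derivative at [y] along [x - y], that
    is, [t <g x, x - y> + <dphi y - dphi x, x - y> >= 0]. The segment from [y]
    to [x] lies both in [K] and in the domain of [phi], so the derivative of
    [phi] at [y] is available even if [y] is only in the relative interior. *)
Lemma bpg_step_first_order g t x : bpg_well_posed K g phi dphi t ->
  ginterior K x -> let y := bpg_step K g phi dphi t x in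
  t * dot (g x) (y - x) <=
    - (fine (bregman phi dphi x y) + fine (bregman phi dphi y x)).
Proof.
move=> wp Kx /=; set y := bpg_step _ _ _ _ _ _.
have Ky : ginterior K y by have [] := wp x Kx.
have [_ ymin] := bpg_step_argmin wp Kx.
have xd := reference_edom Kx; have yd := reference_edom Ky.
rewrite bregman_sym// -(opprB x y) !dotNr mulrN opprK lerNl.
(* [c] is the slope of the part of the objective other than [phi], with its
   sign changed; minimality says that [phi] increases at least at rate [c]. *)
pose c := dot (dphi x - t *: g x) (x - y).
suff : c <= dot (dphi y) (x - y).
  rewrite /c !dotDl !dotNl dotZl.
  lra.
have seg s : 0 < s <= 1 -> edom phi (y + s *: (x - y)).
  by move=> s01; exact: (edom_segment proper (ref_convex phiref) yd xd s01).1.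
apply: (gradient_ge (reference_gradient Ky)) => // s s01 /=.
have := ymin _ (convex_set_segment Kconvex (ginteriorW Ky) (ginteriorW Kx) s01).
rewrite /bpg_objective -/y !(bregmanE proper)//; last exact: seg.
rewrite -!EFinD lee_fin (addrAC y).
rewrite (dotDr (g x) (y - x)) (dotDr (dphi x) (y - x)).
rewrite !dotZr /c dotDl dotNl dotZl.
lra.
Qed.

(** Sufficient decrease. The direction field [g] need not be the gradient [dh]
    of the smooth function: the difference [g x - dh x] is kept as a linear
    term. It vanishes on the fine level, and on the coarse level it is the
    shift that turns [f_H] into the coarse model. *)
Lemma bpg_descent g (h : 'cV[R]_n -> \bar R) dh L t x :
  0 < L -> 0 < t <= L^-1 -> bpg_well_posed K g phi dphi t ->
  (forall u, (-oo < h u)%E) -> relatively_smooth K h dh phi dphi L ->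
  ginterior K `<=` edom h -> ginterior K x ->
  let y := bpg_step K g phi dphi t x in
  fine (h y) - fine (h x) + dot (g x - dh x) (y - x) <=
    - (fine (bregman phi dphi x y) / t).
Proof.
move=> L0 /andP[t0 tL] wp hproper smooth hdom Kx /=.
set y := bpg_step _ _ _ _ _ _.
have Ky : ginterior K y by have [] := wp x Kx.
have := smooth y x (ginteriorW Ky) Kx.
rewrite (bregmanE hproper) //; try exact: hdom.
rewrite -fine_bregmanK// -EFinM lee_fin => hs.
have /= := bpg_step_first_order wp Kx; rewrite -/y => fo.
have tL1 : t * L <= 1 by rewrite -ler_pdivlMr// mul1r.
have D0 := bregman_ge0 Ky Kx.
rewrite -mulNr ler_pdivlMr// dotDl dotNl.
move: (fine (bregman phi dphi y x)) D0 hs fo => D D0 hs fo.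
move: (fine (bregman phi dphi x y)) fo => D' fo.
have := ler_wpM2l (ltW t0) hs.
have := ler_wpM2r D0 tL1.
lra.
Qed.

End bpg_step.

(** Sufficient decrease combined with the growth condition, which controls the
    gap to the minimum by the divergence of a step. *)
Lemma bpg_contraction (R : realType) (n : nat) (C : set 'cV[R]_n)
    (f : 'cV[R]_n -> R) (df : 'cV[R]_n -> 'cV[R]_n) (phi : 'cV[R]_n -> \bar R)
    (dphi : 'cV[R]_n -> 'cV[R]_n) (fmin L th eta t : R) (u : 'cV[R]_n) :
  convex_set C -> reference_function C phi dphi ->
  0 < L -> relatively_smooth C (EFin \o f) df phi dphi L ->
  (forall s, 0 < s -> bpg_well_posed C df phi dphi s) ->
  0 < t <= L^-1 -> 0 < th -> ginterior C u ->
  (th%:E * bregman phi dphi u (bpg_step C df phi dphi 1 u) <=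
    bregman phi dphi u (bpg_step C df phi dphi t u))%E ->
  ((eta * (f u - fmin))%:E <=
    bregman phi dphi u (bpg_step C df phi dphi 1 u))%E ->
  f (bpg_step C df phi dphi t u) - fmin <=
    (1 - th * eta / t) * (f u - fmin).
Proof.
move=> Cconvex phiref L0 smooth wp tL th0 Cu.
have /andP[t0 _] := tL.
have [_ Cu1] := wp 1 ltr01 u Cu; have [_ Cut] := wp t t0 u Cu.
rewrite -(fine_bregmanK phiref Cu Cu1) -(fine_bregmanK phiref Cu Cut).
rewrite -EFinM !lee_fin => growth_t growth_1.
have := @bpg_descent _ _ _ _ _ Cconvex phiref df (EFin \o f) df L t u L0 tL
  (wp t t0) (fun u => ltNyr (f u)) smooth (fun u _ => ltry (f u)) Cu.
rewrite /= dotDl dotNl subrr addr0 => descent.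
have : th * eta / t * (f u - fmin) <=
    fine (bregman phi dphi u (bpg_step C df phi dphi t u)) / t.
  rewrite mulrAC ler_pM2r ?invr_gt0// (le_trans _ growth_t)//.
  by rewrite -mulrA ler_pM2l.
lra.
Qed.

(** * Coarse correction *)

Section coarse_level.
Context {R : realType} {n nH : nat}.
Variables (P : 'M[R]_(n, nH)) (df : 'cV[R]_n -> 'cV[R]_n).
Variables (fH : 'cV[R]_nH -> \bar R) (dfH : 'cV[R]_nH -> 'cV[R]_nH).
Variables (K : set 'cV[R]_nH) (phiH : 'cV[R]_nH -> \bar R).
Variables (dphiH : 'cV[R]_nH -> 'cV[R]_nH) (LH tauH : R) (x : 'cV[R]_n).
Hypotheses (fHproper : forall w, (-oo < fH w)%E) (fHconvex : econvex fH).
Hypotheses (Kconvex : convex_set K) (phiHref : reference_function K phiH dphiH).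
Hypothesis fHdiff : gradient_on (ginterior K) (edom fH) (fine \o fH) dfH.
Hypothesis fHsmooth : relatively_smooth K fH dfH phiH dphiH LH.
Hypotheses (LH0 : 0 < LH) (tauH01 : 0 < tauH <= LH^-1).
Hypothesis wp :
  bpg_well_posed K (coarse_gradient P^T df dfH x) phiH dphiH tauH.
Hypothesis Kx : ginterior K (P^T *m x).

Local Notation xH := (coarse_iterate P^T df dfH K phiH dphiH tauH x).

Lemma coarse_iterate_interior i : ginterior K (xH i).
Proof. by elim: i => [//|i IH]; have [] := wp IH. Qed.

Lemma coarse_bregman_sum_ge0 m :
  0 <= \sum_(1 <= i < m.+1) fine (bregman phiH dphiH (xH i.-1) (xH i)) / tauH.
Proof.
apply: sumr_ge0 => i _; have /andP[/ltW tauH0 _] := tauH01.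
rewrite divr_ge0//; apply: (bregman_ge0 phiHref); exact: coarse_iterate_interior.
Qed.

(** The left-hand side is the variation of the coarse model along the coarse
    iterates, over which the decreases of the single steps telescope. *)
Lemma coarse_descent m :
  fine (fH (xH m)) - fine (fH (xH 0)) +
    dot (coarse_shift P^T df dfH x) (xH m - xH 0) <=
  - \sum_(1 <= i < m.+1) fine (bregman phiH dphiH (xH i.-1) (xH i)) / tauH.
Proof.
elim: m => [|m IH].
  by rewrite big_geq// subrr add0r dotDr dotNr subrr oppr0.
rewrite big_nat_recr// -[m.+1.-1]/m opprD.
have hdom : ginterior K `<=` edom fH by move=> w /fHdiff[].
have := bpg_descent Kconvex phiHref LH0 tauH01 wp fHproper fHsmooth hdom
  (coarse_iterate_interior m).
rewrite -[bpg_step _ _ _ _ _ _]/(xH m.+1) /coarse_gradient (addrC (dfH _)) addrK.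
have -> : xH m.+1 - xH 0 = (xH m.+1 - xH m) + (xH m - xH 0).
  by rewrite addrA subrK.
rewrite (dotDr _ (xH m.+1 - xH m)); lra.
Qed.

(** First-order coherence: [P^T (df x)] is the gradient of the coarse model at
    the restricted point, so the slope of [f] along the prolonged correction is
    a slope of the convex coarse model, at most its variation. *)
Lemma coarse_direction_descent m :
  dot (df x) (coarse_direction P^T P df dfH K phiH dphiH tauH m x) <=
  - \sum_(1 <= i < m.+1) fine (bregman phiH dphiH (xH i.-1) (xH i)) / tauH.
Proof.
apply: le_trans (coarse_descent m); rewrite /coarse_direction dot_mulmx.
have -> : P^T *m df x = dfH (xH 0) + coarse_shift P^T df dfH x.
  by rewrite /coarse_shift addrC subrK.
rewrite dotDl lerD2r; apply: (gradient_inequality fHproper fHconvex).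
  exact: (fHdiff (coarse_iterate_interior 0)).
by have [] := fHdiff (coarse_iterate_interior m).
Qed.

End coarse_level.

(** * The recurrence for the gaps *)

Lemma linear_recurrence_bound (R : realDomainType) (q : R) (F rho : nat -> R) :
  0 <= q -> (forall k, F k.+1 <= q * (F k - rho k)) ->
  forall k, F k <= q ^+ k * F 0%N - \sum_(0 <= j < k) q ^+ (k - j) * rho j.
Proof.
move=> q0 rec; elim=> [|k IH]; first by rewrite big_geq// expr0 mul1r subr0.
apply: le_trans (rec k) _; rewrite big_nat_recr//= subSnn expr1 exprS.
have -> : \sum_(0 <= j < k) q ^+ (k.+1 - j) * rho j =
          q * \sum_(0 <= j < k) q ^+ (k - j) * rho j.
  rewrite big_distrr /=; apply: eq_big_nat => j /andP[_ jk].
  by rewrite subSn 1?ltnW// exprS mulrA.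
rewrite opprD addrA -mulrA -!mulrBr ler_wpM2l// lerD2r//.
Qed.

(** [F k] is the gap at an iterate and [G] the gap at the corrected point from
    which the fine step starts. Nothing bounds [r] by [1] in advance, and for
    [r > 1] the recurrence cannot be multiplied through by [1 - r]; but then
    [(1 - r) F k >= 0], which holds because a fine step taken directly from the
    iterate also contracts, leaves only the degenerate case of zero gaps. *)
Lemma contraction_convergence (R : realType) (r : R) (F rho : nat -> R) :
  0 < r -> (forall k, 0 <= rho k) -> (forall k, 0 <= (1 - r) * F k) ->
  (forall k, exists2 G, 0 <= G <= F k - rho k & F k.+1 <= (1 - r) * G) ->
  F @ \oo --> 0 /\
  forall k, F k <= (1 - r) ^+ k * F 0%N -
    \sum_(0 <= j < k) (1 - r) ^+ (k - j) * rho j.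
Proof.
move=> r0 rho0 qF rec.
have rhoF k : rho k <= F k by have [G /andP[? ?] _] := rec k; lra.
have F0 k : 0 <= F k := le_trans (rho0 k) (rhoF k).
have [q0|q0] := leP 0 (1 - r); last first.
  have FE k : F k = 0.
    by apply/eqP; rewrite eq_le F0 andbT; have := qF k; rewrite nmulr_rge0.
  have rhoE k : rho k = 0.
    by apply/eqP; rewrite eq_le rho0 andbT; have := rhoF k; rewrite FE.
  split=> [|k]; first by rewrite (_ : F = fun=> 0); [exact: cvg_cst|exact/funext].
  by rewrite !FE mulr0 big1 ?subrr// => j _; rewrite rhoE mulr0.
have bound k : F k <= (1 - r) ^+ k * F 0%N -
    \sum_(0 <= j < k) (1 - r) ^+ (k - j) * rho j.
  apply: linear_recurrence_bound => // {}k.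
  have [G /andP[_ GF] FG] := rec k.
  exact: le_trans FG (ler_wpM2l q0 GF).
split=> //.
apply: (@squeeze_cvgr _ _ _ _ (fun=> 0) (geometric (F 0%N) (1 - r))).
- apply: nearW => k; rewrite F0 /= (le_trans (bound k))// mulrC gerBl.
  by apply: sumr_ge0 => j _; rewrite mulr_ge0// exprn_ge0.
- exact: cvg_cst.
- by apply: cvg_geometric; rewrite ger0_norm//; lra.
Qed.

Theorem theorem3p6 (R : realType) (n nH : nat)
    (* fine level: f on C, gradient field df, minimum fmin *)
    (C : set 'cV[R]_n) (f : 'cV[R]_n -> R) (df : 'cV[R]_n -> 'cV[R]_n)
    (fmin : R)
    (hCclosed : closed C) (hCconvex : convex_set C)
    (hfconvex : convex_function C f)
    (hfdiff : gradient_on C C f df)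
    (hfmin : (exists2 xs, C xs & f xs = fmin) /\ forall u, C u -> fmin <= f u)
    (* reference functions, transfer operators and coarse function *)
    (phi : 'cV[R]_n -> \bar R) (dphi : 'cV[R]_n -> 'cV[R]_n)
    (phiH : 'cV[R]_nH -> \bar R) (dphiH : 'cV[R]_nH -> 'cV[R]_nH)
    (Rs : 'M[R]_(nH, n)) (P : 'M[R]_(n, nH)) (hRP : Rs = P^T)
    (fH : 'cV[R]_nH -> \bar R) (dfH : 'cV[R]_nH -> 'cV[R]_nH)
    (hfHproper : forall w, (-oo < fH w)%E) (hfHconvex : econvex fH)
    (hphi : reference_function C phi dphi)
    (* (A) *)
    (L : R) (hL : 0 < L)
    (hsmooth : relatively_smooth C (EFin \o f) df phi dphi L)
    (hstep : forall t : R, 0 < t -> bpg_well_posed C df phi dphi t)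
    (* (B) *)
    (theta : R -> R) (htheta : forall t, 0 < t -> 0 < theta t)
    (eta : R) (heta : 0 < eta)
    (hgrowth : forall (u : 'cV[R]_n) (t : R), ginterior C u -> 0 < t ->
       ((theta t)%:E * bregman phi dphi u (bpg_step C df phi dphi 1 u)
          <= bregman phi dphi u (bpg_step C df phi dphi t u))%E /\
       ((eta * (f u - fmin))%:E
          <= bregman phi dphi u (bpg_step C df phi dphi 1 u))%E)
    (* step sizes, number of coarse steps and line search parameters *)
    (LH : R) (hLH : 0 < LH)
    (tau : R) (htau : 0 < tau <= L^-1)
    (tauH : R) (htauH : 0 < tauH <= LH^-1)
    (m : nat) (hm : (1 <= m)%N)
    (abar beta sigma : R) (habar : 0 < abar) (hbeta : 0 < beta < 1)
    (hsigma : 0 < sigma < 1)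
    (* trigger decisions, coarse constraint sets, iterates, steps *)
    (trig : nat -> bool) (CH : nat -> set 'cV[R]_nH)
    (x : nat -> 'cV[R]_n) (alpha : nat -> R)
    (hCHclosed : forall k, closed (CH k))
    (hCHconvex : forall k, convex_set (CH k))
    (hCHsub : forall k, CH k `<=` [set w | C (x k + P *m (w - Rs *m x k))])
    (hCHint : forall k, ginterior (CH k) (Rs *m x k))
    (hphiH : forall k, reference_function (CH k) phiH dphiH)
    (hfHdiff : forall k,
       gradient_on (ginterior (CH k)) (edom fH) (fine \o fH) dfH)
    (* (C) *)
    (hsmoothH : forall k, relatively_smooth (CH k) fH dfH phiH dphiH LH)
    (hstepH : forall k,
       bpg_well_posed (CH k) (coarse_gradient Rs df dfH (x k)) phiH dphiH tauH)
    (* two-level BPGD with Armijo line search *)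
    (hx0 : ginterior C (x 0%N))
    (hfine : forall k, ~~ trig k -> x k.+1 = bpg_step C df phi dphi tau (x k))
    (hcoarse : forall k, trig k ->
       let d := coarse_direction Rs P df dfH (CH k) phiH dphiH tauH m (x k) in
       let z := x k + alpha k *: d in
       [/\ armijo_step C f df abar beta sigma (x k) d (alpha k),
           0 < alpha k <= 1,
           ginterior C z &
           x k.+1 = bpg_step C df phi dphi tau z]) :
  let r := theta tau * eta / tau in
  let xH j i := coarse_iterate Rs df dfH (CH j) phiH dphiH tauH (x j) i in
  (* all iterates xH j i are in ginterior (CH j), so these divergences are
     finite *)
  let rho j :=
    if trig j then
      sigma * alpha j *
        \sum_(1 <= i < m.+1) fine (bregman phiH dphiH (xH j i.-1) (xH j i)) / tauH
    else 0 in
  (f \o x) @ \oo --> fmin /\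
  forall k : nat,
    f (x k) - fmin <=
      (1 - r) ^+ k * (f (x 0%N) - fmin) -
      \sum_(0 <= j < k) (1 - r) ^+ (k - j) * rho j.

Proof.
subst Rs => r xH rho.
have /andP[tau0 _] := htau; have /andP[sigma0 _] := hsigma.
have r0 : 0 < r by rewrite divr_gt0// mulr_gt0// htheta.
have gap_ge0 u : ginterior C u -> 0 <= f u - fmin.
  by move=> /ginteriorW Cu; rewrite subr_ge0 hfmin.2.
pose u' u := bpg_step C df phi dphi tau u.
have intS u : ginterior C u -> ginterior C (u' u).
  by move=> Cu; have [] := hstep tau tau0 u Cu.
have contr u : ginterior C u -> f (u' u) - fmin <= (1 - r) * (f u - fmin).
  move=> Cu; have [growth_tau growth_1] := hgrowth u tau Cu tau0.
  exact: (bpg_contraction hCconvex hphi hL hsmooth hstep htau (htheta _ tau0)).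
(* Both kinds of iteration are a fine step from some [z]; without a coarse
   correction [z] is the iterate itself. *)
have iterP k : ginterior C (x k) ->
    exists z, [/\ ginterior C z, x k.+1 = u' z, 0 <= rho k &
      f z - fmin <= f (x k) - fmin - rho k].
  move=> Cx; rewrite /rho; case: ifPn => trigk; last first.
    by exists (x k); rewrite hfine// subr0; split.
  have [[p [<- [_ armijo] _]] /andP[a0 _] Cz xS] := hcoarse k trigk.
  have descent := coarse_direction_descent hfHproper hfHconvex (hCHconvex k)
    (hphiH k) (hfHdiff k) (hsmoothH k) hLH htauH (hstepH k) (hCHint k) m.
  have sum0 := coarse_bregman_sum_ge0 (hphiH k) htauH (hstepH k) (hCHint k) m.
  set d := coarse_direction _ _ _ _ _ _ _ _ _ _ in armijo Cz xS descent.
  set D := \sum_(_ <= i < _) _ in descent sum0 *.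
  have sa0 : 0 < sigma * alpha k by rewrite mulr_gt0.
  exists (x k + alpha k *: d); split=> //; first by rewrite mulr_ge0// ltW.
  have := ler_wpM2l (ltW sa0) descent; rewrite -/D mulrN; lra.
have intx k : ginterior C (x k).
  by elim: k => // k /iterP[z [Cz -> _ _]]; exact: intS.
have [cvg_gap bound] : (fun k => f (x k) - fmin) @ \oo --> 0 /\
    forall k, f (x k) - fmin <= (1 - r) ^+ k * (f (x 0%N) - fmin) -
      \sum_(0 <= j < k) (1 - r) ^+ (k - j) * rho j.
  apply: (contraction_convergence r0) => k.
  - by have [z []] := iterP k (intx k).
  - by apply: le_trans (contr _ (intx k)); exact/gap_ge0/intS.
  - have [z [Cz -> _ zx]] := iterP k (intx k).
    by exists (f z - fmin); [rewrite gap_ge0|exact: contr].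
split=> //.
rewrite (_ : f \o x = (fun k => f (x k) - fmin) \+ fun=> fmin).
  by rewrite -[X in _ --> X]add0r; apply: cvgD => //; exact: cvg_cst.
by apply/funext => k /=; rewrite subrK.
Qed.
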